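(* Let $X$ be a switch, and let $\mathcal{B}_n$ be the $n$-strand braid group. Then the map $\varphi_B:X^n\to X^n$ is a switch homomorphism (where $X^n$ carries the product switch structure) for every braid $B\in\mathcal{B}_n$ if and only if $X$ is medial.
   Context: A switch is a set $X$ with an invertible map $\rho:X\times X\to X\times X$ satisfying the set-theoretic Yang-Baxter equation $(\rho\times\mathrm{Id}_X)(\mathrm{Id}_X\times\rho)(\rho\times\mathrm{Id}_X)=(\mathrm{Id}_X\times\rho)(\rho\times\mathrm{Id}_X)(\mathrm{Id}_X\times\rho)$. Write $\rho=(\rho_1,\rho_2)$ and define binary operations on $X$ by $x\mathbin{\underline{\triangledown}}y=\rho_2(x,y)$ and $x\mathbin{\overline{\triangledown}}y=\rho_1(y,x)$, so that $\rho(x,y)=(y\mathbin{\overline{\triangledown}}x,\;x\mathbin{\underline{\triangledown}}y)$. The product switch structure on $X^n$ is the one whose operations $\underline{\triangledown},\overline{\triangledown}$ are computed componentwise from those of $X$, i.e. its switch map sends $((x_i)_i,(y_i)_i)$ to $((\rho_1(x_i,y_i))_i,(\rho_2(x_i,y_i))_i)$. A switch homomorphism from $(X,\rho)$ to $(Y,\tau)$ is a map $f:X\to Y$ with $\tau(f(x),f(y))=(f(\rho_1(x,y)),f(\rho_2(x,y)))$ for all $x,y\in X$; equivalently, $f$ preserves both operations $\underline{\triangledown}$ and $\overline{\triangledown}$. A switch $X$ is medial if for all $x,y,w,z\in X$: $(x\mathbin{\underline{\triangledown}}y)\mathbin{\underline{\triangledown}}(w\mathbin{\underline{\triangledown}}z)=(x\mathbin{\underline{\triangledown}}w)\mathbin{\underline{\triangledown}}(y\mathbin{\underline{\triangledown}}z)$,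 $(x\mathbin{\underline{\triangledown}}y)\mathbin{\overline{\triangledown}}(w\mathbin{\underline{\triangledown}}z)=(x\mathbin{\overline{\triangledown}}w)\mathbin{\underline{\triangledown}}(y\mathbin{\overline{\triangledown}}z)$, $(x\mathbin{\overline{\triangledown}}y)\mathbin{\overline{\triangledown}}(w\mathbin{\overline{\triangledown}}z)=(x\mathbin{\overline{\triangledown}}w)\mathbin{\overline{\triangledown}}(y\mathbin{\overline{\triangledown}}z)$. $\mathcal{B}_n$ is the $n$-strand braid group with Artin generators $\sigma_1,\dots,\sigma_{n-1}$; the product is vertical stacking, words being read from top to bottom. For $B\in\mathcal{B}_n$, $\varphi_B:X^n\to X^n$ sends the vector of colors at the top of $B$ to the vector of colors induced at the bottom: $\varphi_{\sigma_i}(x_1,\dots,x_n)=(x_1,\dots,x_{i-1},\rho_1(x_i,x_{i+1}),\rho_2(x_i,x_{i+1}),x_{i+2},\dots,x_n)$, $\varphi_{\sigma_i^{-1}}=\varphi_{\sigma_i}^{-1}$, and $\varphi_{B_1B_2}=\varphi_{B_2}\circ\varphi_{B_1}$. (It is known that this is well defined on $\mathcal{B}_n$.)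
   Formalization: The formal theorem assumes n ≥ 2: for n ≤ 1 the braid group is trivial and every φ_B is the identity, so the ''only if'' direction fails for any non-medial switch, such as conjugation on S_3. *)

(* Defs.v *)
From HB Require Import structures.
From mathcomp Require Import all_boot.
From mathcomp Require Import boolp.

Set Implicit Arguments.
Unset Strict Implicit.
Unset Printing Implicit Defensive.

Section YangBaxter.
Variables (X : Type) (r : X * X -> X * X).

(* r x Id and Id x r on X * X * X = (X * X) * X *)
Definition ybL (t : X * X * X) : X * X * X := (r t.1, t.2).
Definition ybR (t : X * X * X) : X * X * X :=
  let: (x, y, z) := t in let: (y', z') := r (y, z) in (x, y', z').

Definition yang_baxter := ybL \o ybR \o ybL =1 ybR \o ybL \o ybR.

End YangBaxter.

(* The inverse map is carried as data; it is determined by rho. *)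
HB.mixin Record isSwitch X := {
  rho : X * X -> X * X;
  rhoV : X * X -> X * X;
  rhoK : cancel rho rhoV;
  rhoVK : cancel rhoV rho;
  rho_yb : yang_baxter rho
}.

#[short(type="switchType")]
HB.structure Definition Switch := {X of isSwitch X}.

Definition underop (X : switchType) (x y : X) : X := (rho (x, y)).2.
Definition overop (X : switchType) (x y : X) : X := (rho (y, x)).1.

Declare Scope switch_scope.
Delimit Scope switch_scope with switch.
Notation "x \under y" := (underop x y)
  (at level 40, left associativity) : switch_scope.
Notation "x \over y" := (overop x y)
  (at level 40, left associativity) : switch_scope.
Local Open Scope switch_scope.

Lemma rhoE (X : switchType) (x y : X) : rho (x, y) = (y \over x, x \under y).
Proof. exact: surjective_pairing. Qed.

Definition switch_hom (X Y : switchType) (f : X -> Y) : Prop :=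
  forall x y, rho (f x, f y) = (f (rho (x, y)).1, f (rho (x, y)).2).

Lemma switch_homP (X Y : switchType) (f : X -> Y) :
  switch_hom f <-> {morph f : x y / x \under y} /\ {morph f : x y / x \over y}.
Proof.
split=> [hf|[hu ho] x y]; first by split=> x y; rewrite /underop /overop hf.
by rewrite !rhoE -hu -ho.
Qed.

Definition medial (X : switchType) : Prop := forall x y w z : X,
  [/\ (x \under y) \under (w \under z) = (x \under w) \under (y \under z),
      (x \under y) \over (w \under z) = (x \over w) \under (y \over z) &
      (x \over y) \over (w \over z) = (x \over w) \over (y \over z)].

Section ProductSwitch.
Variables (I : finType) (X : switchType).
Local Notation P := {ffun I -> X}.

Definition prod_map (r : X * X -> X * X) (p : P * P) : P * P :=
  ([ffun i => (r (p.1 i, p.2 i)).1], [ffun i => (r (p.1 i, p.2 i)).2]).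

Lemma prod_mapK r s : cancel r s -> cancel (prod_map r) (prod_map s).
Proof.
move=> rK [x y]; congr pair; apply/ffunP=> i; rewrite !ffunE /=.
  by rewrite -surjective_pairing rK.
by rewrite -surjective_pairing rK.
Qed.

Let ev (i : I) (t : P * P * P) : X * X * X := (t.1.1 i, t.1.2 i, t.2 i).

Lemma prod_map_yb r : yang_baxter r -> yang_baxter (prod_map r).
Proof.
move=> yb t.
have evL i u : ev i (ybL (prod_map r) u) = ybL r (ev i u).
  by rewrite /ev /ybL /= !ffunE -surjective_pairing.
have evR i u : ev i (ybR (prod_map r) u) = ybR r (ev i u).
  by case: u => [[x y] z]; rewrite /ev /ybR /= !ffunE; case: (r _).
have ev_inj u v : (forall i, ev i u = ev i v) -> u = v.
  case: u v => [[x y] z] [[x' y'] z'] /= e.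
  by congr (_, _, _); apply/ffunP=> i; have [] := e i.
by apply: ev_inj => i; rewrite /comp !(evL, evR); apply: yb.
Qed.

HB.instance Definition _ := isSwitch.Build P
  (prod_mapK (@rhoK X)) (prod_mapK (@rhoVK X)) (prod_map_yb (@rho_yb X)).

Lemma under_ffunE (x y : P) i : (x \under y) i = x i \under y i.
Proof. by rewrite /underop ffunE. Qed.

Lemma over_ffunE (x y : P) i : (x \over y) i = x i \over y i.
Proof. by rewrite /overop ffunE. Qed.

End ProductSwitch.

Section BraidGroup.
Variable n : nat.

(* A letter (i, true) stands for the Artin generator on the strands in
   positions i and i.+1 (counted from 0), and (i, false) for its inverse. *)
Definition bletter : Type := ('I_n.-1 * bool)%type.
Definition bword : Type := seq bletter.
HB.instance Definition _ := Countable.on bletter.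
HB.instance Definition _ := Countable.on bword.

Inductive brelator : bword -> bword -> Prop :=
| BCancel i b : brelator [:: (i, b); (i, ~~ b)] [::]
| BFar (i j : 'I_n.-1) : i.+1 < j ->
    brelator [:: (i, true); (j, true)] [:: (j, true); (i, true)]
| BBraid (i j : 'I_n.-1) : i.+1 = j ->
    brelator [:: (i, true); (j, true); (i, true)]
             [:: (j, true); (i, true); (j, true)].

Inductive beq : bword -> bword -> Prop :=
| BStep p u v s : brelator u v -> beq (p ++ u ++ s) (p ++ v ++ s)
| BRefl u : beq u u
| BSym u v : beq u v -> beq v u
| BTrans u v w : beq u v -> beq v w -> beq u w.

Lemma beq_ctx p s u v : beq u v -> beq (p ++ u ++ s) (p ++ v ++ s).
Proof.
elim=> [p' u' v' s' h|u'|u' v' _|u' v' w' _ h1 _ h2].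
- by rewrite -!catA (catA p) (catA p p'); apply: BStep.
- exact: BRefl.
- exact: BSym.
- exact: BTrans h1 h2.
Qed.

Lemma beq_cat u u' v v' : beq u u' -> beq v v' -> beq (u ++ v) (u' ++ v').
Proof.
move=> h1 h2; apply: (@BTrans _ (u' ++ v)).
  exact: (beq_ctx [::] v h1).
by have := beq_ctx u' [::] h2; rewrite !cats0.
Qed.

(* The quotient construction wants a boolean relation. *)
Definition beqb : rel bword := fun u v => `[< beq u v >].

Lemma beqb_refl : reflexive beqb.
Proof. by move=> u; apply/asboolP/BRefl. Qed.
Lemma beqb_sym : symmetric beqb.
Proof. by move=> u v; apply/asboolP/asboolP; apply: BSym. Qed.
Lemma beqb_trans : transitive beqb.
Proof.
by move=> v u w /asboolP h1 /asboolP h2; apply/asboolP/(BTrans h1 h2).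
Qed.

Canonical beqb_equiv := EquivRel beqb beqb_refl beqb_sym beqb_trans.

Definition braid : Type := {eq_quot beqb}%qT.
HB.instance Definition _ := Choice.on braid.
HB.instance Definition _ := Quotient.on braid.

Definition bclass (w : bword) : braid := (\pi w)%qT.

Lemma bclassP u v : bclass u = bclass v <-> beq u v.
Proof. by split=> [/eqmodP/asboolP|h] //; apply/eqmodP/asboolP. Qed.

Lemma breprK B : bclass (repr B) = B.
Proof. exact: reprK. Qed.

Lemma beq_repr w : beq (repr (bclass w)) w.
Proof. by apply/bclassP; rewrite breprK. Qed.

Definition bword_inv (w : bword) : bword :=
  rev [seq (l.1, ~~ l.2) | l <- w].

Lemma bword_invK : involutive bword_inv.
Proof.
move=> w; rewrite /bword_inv map_rev revK -map_comp -[RHS]map_id.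
by apply: eq_map => -[i b] /=; rewrite negbK.
Qed.

Lemma bword_mulV w : beq (w ++ bword_inv w) [::].
Proof.
elim: w => [|[i b] w IH]; first exact: BRefl.
rewrite /bword_inv /= rev_cons -cats1 -/(bword_inv w).
apply: (@BTrans _ ([:: (i, b)] ++ [::] ++ [:: (i, ~~ b)])).
  by have := beq_ctx [:: (i, b)] [:: (i, ~~ b)] IH; rewrite -catA.
by have := BStep [::] [::] (BCancel i b).
Qed.

Definition braid_one : braid := bclass [::].
Definition braid_mul (A B : braid) : braid := bclass (repr A ++ repr B).
Definition braid_inv (B : braid) : braid := bclass (bword_inv (repr B)).

Lemma bclass_cat u v : bclass (u ++ v) = braid_mul (bclass u) (bclass v).
Proof. by apply/bclassP/beq_cat; apply/BSym/beq_repr. Qed.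

Lemma braid_mulA : associative braid_mul.
Proof.
move=> A B C; rewrite -[A]breprK -[B]breprK -[C]breprK.
by rewrite -!bclass_cat catA.
Qed.
Lemma braid_mul1 : left_id braid_one braid_mul.
Proof. by move=> A; rewrite -[A]breprK -bclass_cat. Qed.
Lemma braid_mulr1 : right_id braid_one braid_mul.
Proof. by move=> A; rewrite -[A]breprK -bclass_cat cats0. Qed.
Lemma braid_mulrV : right_inverse braid_one braid_inv braid_mul.
Proof.
move=> A; rewrite -{1}[A]breprK -bclass_cat.
exact/bclassP/bword_mulV.
Qed.
Lemma braid_mulVr : left_inverse braid_one braid_inv braid_mul.
Proof.
move=> A; rewrite -{2}[A]breprK -bclass_cat; apply/bclassP.
by rewrite -{2}[repr A]bword_invK; apply: bword_mulV.
Qed.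

HB.instance Definition _ := isGroup.Build braid
  braid_mulA braid_mul1 braid_mulr1 braid_mulVr braid_mulrV.

Definition sigma (i : 'I_n.-1) : braid := bclass [:: (i, true)].

Lemma sigmaV i : (sigma i)^-1%g = bclass [:: (i, false)].
Proof.
apply: (mulgI (sigma i)); rewrite mulgV; symmetry.
rewrite -[LHS]bclass_cat; apply/bclassP.
exact: (BStep [::] [::] (BCancel i true)).
Qed.

End BraidGroup.

Section BraidAction.
Variables (X : switchType) (n : nat).
Local Notation colors := (X ^ n)%type.

Lemma rpos_subproof (i : 'I_n.-1) : i.+1 < n.
Proof. by rewrite -ltn_predRL. Qed.

Definition lpos (i : 'I_n.-1) : 'I_n := widen_ord (leq_pred n) i.
Definition rpos (i : 'I_n.-1) : 'I_n := Ordinal (rpos_subproof i).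

Definition act_at (r : X * X -> X * X) (i : 'I_n.-1) (x : colors) : colors :=
  [ffun k => if k == lpos i then (r (x (lpos i), x (rpos i))).1
             else if k == rpos i then (r (x (lpos i), x (rpos i))).2
             else x k].

Definition phi_letter (l : bletter n) : colors -> colors :=
  act_at (if l.2 then @rho X else @rhoV X) l.1.

(* The head of a word is the top of the braid, so it acts first. *)
Fixpoint phi_word (w : bword n) (x : colors) : colors :=
  if w is l :: w' then phi_word w' (phi_letter l x) else x.

(* The choice of the word [repr B] is immaterial: see phi_class. *)
Definition phi (B : braid n) : colors -> colors := phi_word (repr B).

Lemma phi_word_cat u v x : phi_word (u ++ v) x = phi_word v (phi_word u x).
Proof. by elim: u x => /=. Qed.

Lemma rpos_neq i : (rpos i == lpos i) = false.
Proof. by rewrite -val_eqE /= gtn_eqF. Qed.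

Lemma act_atl r i x : act_at r i x (lpos i) = (r (x (lpos i), x (rpos i))).1.
Proof. by rewrite ffunE eqxx. Qed.
Lemma act_atr r i x : act_at r i x (rpos i) = (r (x (lpos i), x (rpos i))).2.
Proof. by rewrite ffunE rpos_neq eqxx. Qed.
Lemma act_atN r i x k :
  k != lpos i -> k != rpos i -> act_at r i x k = x k.
Proof. by rewrite ffunE => /negPf-> /negPf->. Qed.

Lemma act_atK r s i : cancel r s -> cancel (act_at r i) (act_at s i).
Proof.
move=> rK x; apply/ffunP=> k; rewrite [LHS]ffunE act_atl act_atr.
rewrite -surjective_pairing rK /=.
case: (k =P lpos i) => [->//|/eqP k1]; case: (k =P rpos i) => [->//|/eqP k2].
exact: act_atN.
Qed.

Lemma phi_letterK i b : cancel (phi_letter (i, b)) (phi_letter (i, ~~ b)).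
Proof. by case: b; apply: act_atK; [apply: rhoK | apply: rhoVK]. Qed.

Lemma act_at_far r (i j : 'I_n.-1) x : i.+1 < j ->
  act_at r i (act_at r j x) = act_at r j (act_at r i x).
Proof.
move=> ij.
have [d1 d2] : lpos i != lpos j /\ lpos i != rpos j.
  by split; rewrite -val_eqE /= ltn_eqF // ltnW // ?ltnS ltnW.
have [d3 d4] : rpos i != lpos j /\ rpos i != rpos j.
  by split; rewrite -val_eqE /= ltn_eqF // ltnW.
apply/ffunP=> k; rewrite [LHS]ffunE [RHS]ffunE.
rewrite (act_atN _ _ d1 d2) (act_atN _ _ d3 d4).
rewrite [act_at r i x (lpos j)]act_atN 1?eq_sym //.
rewrite [act_at r i x (rpos j)]act_atN 1?eq_sym // 2!ffunE.
case: (k =P lpos i) => [->|_]; first by rewrite (negPf d1) (negPf d2).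
by case: (k =P rpos i) => [->|_] //; rewrite (negPf d3) (negPf d4).
Qed.

Lemma act_at_braid r (i j : 'I_n.-1) x : yang_baxter r -> i.+1 = j ->
  act_at r i (act_at r j (act_at r i x)) =
  act_at r j (act_at r i (act_at r j x)).
Proof.
move=> yb ij.
have eij : rpos i = lpos j by apply: val_inj; rewrite /= ij.
have d1 : lpos i != lpos j by rewrite -val_eqE /= -ij ltn_eqF.
have d2 : lpos i != rpos j by rewrite -val_eqE /= -ij ltn_eqF.
have d3 : rpos j != lpos i by rewrite eq_sym.
have d4 : rpos j != rpos i by rewrite eij rpos_neq.
pose ev (y : colors) := (y (lpos i), y (lpos j), y (rpos j)).
have evL y : ev (act_at r i y) = ybL r (ev y).
  by rewrite /ev /ybL /= act_atl -eij act_atr act_atN // -surjective_pairing.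
have evR y : ev (act_at r j y) = ybR r (ev y).
  by rewrite /ev /ybR /= act_atl act_atr act_atN //; case: (r _).
have : ev (act_at r i (act_at r j (act_at r i x))) =
       ev (act_at r j (act_at r i (act_at r j x))).
  by rewrite !(evL, evR); apply: yb.
rewrite /ev => -[E1 E2 E3]; apply/ffunP=> k.
have [->//|k1] := eqVneq k (lpos i).
have [->//|k2] := eqVneq k (lpos j).
have [->//|k3] := eqVneq k (rpos j).
by rewrite !act_atN // eij.
Qed.

Lemma phi_relator u v : brelator u v -> phi_word u =1 phi_word v.
Proof.
case=> [i b|i j ij|i j ij] x.
- exact: (phi_letterK i b x).
- by rewrite /= /phi_letter /= (act_at_far _ _ ij).
- by rewrite /= /phi_letter /= (act_at_braid _ (@rho_yb X) ij).
Qed.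

Lemma phi_beq u v : beq u v -> phi_word u =1 phi_word v.
Proof.
elim=> [p u' v' s /phi_relator h x|u' //|u' v' _ h x|u' v' w _ h1 _ h2 x].
- by rewrite !phi_word_cat h.
- by rewrite h.
- by rewrite h1.
Qed.

Lemma phi_class w : phi (bclass w) =1 phi_word w.
Proof. exact/phi_beq/beq_repr. Qed.

Lemma phi_sigma i : phi (sigma i) =1 act_at (@rho X) i.
Proof. by move=> x; rewrite phi_class. Qed.

Lemma phi1 : phi 1%g =1 id.
Proof. exact: phi_class. Qed.

Lemma phiM A B : phi (A * B)%g =1 phi B \o phi A.
Proof. by move=> x; rewrite phi_class phi_word_cat. Qed.

Lemma phiK B : cancel (phi B) (phi B^-1%g).
Proof. by move=> x; rewrite -[LHS]phiM mulgV phi1. Qed.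

Lemma phiVK B : cancel (phi B^-1%g) (phi B).
Proof. by move=> x; rewrite -[LHS]phiM mulVg phi1. Qed.

End BraidAction.

(* Main.v *)
Require Import Defs.
From mathcomp Require Import all_boot.

(** Arrange four colors in a 2 x 2 array. The medial identities say exactly
    that applying the switch map [rho] to the rows commutes with applying it
    to the columns. For a single crossing, the pair of strands that meet is one
    direction of the array and the pair of color vectors being combined in the
    product switch is the other, so one Artin generator acts by a switch
    homomorphism iff [X] is medial ([switch_hom_crossing]); the strands away
    from the crossing impose no condition.

    Everything else is formal: the inverse of a bijective homomorphism is a
    homomorphism, so the inverse generators come for free, and every braid acts
    by a composite of generators and their inverses. Conversely, as [n >= 2]
    there is at least one generator, and its action alone forces mediality. *)

Local Open Scope switch_scope.

Lemma switch_hom_comp (X Y Z : switchType) (f : X -> Y) (g : Y -> Z) :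
  switch_hom f -> switch_hom g -> switch_hom (g \o f).
Proof. by move=> hf hg x y; rewrite /= hg hf. Qed.

Lemma switch_hom_inv (X Y : switchType) (f : X -> Y) (g : Y -> X) :
  cancel f g -> cancel g f -> switch_hom f -> switch_hom g.
Proof.
move=> fK gK hf x y.
by rewrite -{2 3}[x]gK -{2 3}[y]gK hf !fK -surjective_pairing.
Qed.

Lemma eq_switch_hom (X Y : switchType) (f g : X -> Y) :
  f =1 g -> switch_hom f -> switch_hom g.
Proof. by move=> fg hf x y; rewrite -!fg. Qed.

Section Crossing.
Variables (X : switchType) (n : nat) (i : 'I_n.-1).

Lemma crossing_lpos (x : X ^ n) :
  act_at (@rho X) i x (lpos i) = x (rpos i) \over x (lpos i).
Proof. exact: act_atl. Qed.

Lemma crossing_rpos (x : X ^ n) :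
  act_at (@rho X) i x (rpos i) = x (lpos i) \under x (rpos i).
Proof. exact: act_atr. Qed.

(** On a strand that does not meet the crossing both sides of the homomorphism
    equation are the same entry. On the two strands that cross, the left one
    yields the over-operation of the crossing and the right one the
    under-operation, and each of these must preserve both operations of [X]:
    these four equations are the medial identities, the mixed one occurring
    twice. *)
Lemma switch_hom_crossing : switch_hom (act_at (@rho X) i) <-> medial X.
Proof.
split=> [/switch_homP[hu ho] x y w z|med].
  (* Only the two strands that cross matter, so vectors with two values
     suffice to read the identities off. *)
  pose v (a b : X) : (X ^ n)%type := [ffun k => if k == lpos i then a else b].
  have vl a b : v a b (lpos i) = a by rewrite ffunE eqxx.
  have vr a b : v a b (rpos i) = b by rewrite ffunE rpos_neq.
  split.
  - have /ffunP/(_ (rpos i)) := hu (v x w) (v y z).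
    by rewrite !(crossing_rpos, under_ffunE, vl, vr).
  - (* The over-operation reads its arguments from right to left. *)
    have /ffunP/(_ (lpos i)) := hu (v w x) (v z y).
    by rewrite !(crossing_lpos, under_ffunE, vl, vr).
  - have /ffunP/(_ (lpos i)) := ho (v w x) (v z y).
    by rewrite !(crossing_lpos, over_ffunE, vl, vr).
apply/switch_homP; split=> x y; apply/ffunP=> k.
- rewrite under_ffunE; have [->|kl] := eqVneq k (lpos i).
    rewrite !(crossing_lpos, under_ffunE).
    by case: (med (x (rpos i)) (y (rpos i)) (x (lpos i)) (y (lpos i))).
  have [->|kr] := eqVneq k (rpos i).
    rewrite !(crossing_rpos, under_ffunE).
    by case: (med (x (lpos i)) (y (lpos i)) (x (rpos i)) (y (rpos i))).
  by rewrite !act_atN // under_ffunE.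
- rewrite over_ffunE; have [->|kl] := eqVneq k (lpos i).
    rewrite !(crossing_lpos, over_ffunE).
    by case: (med (x (rpos i)) (y (rpos i)) (x (lpos i)) (y (lpos i))).
  have [->|kr] := eqVneq k (rpos i).
    (* Of the four entries of the array, the two off-diagonal ones give the
       same mixed identity; this one reads it from right to left. *)
    rewrite !(crossing_rpos, over_ffunE).
    by case: (med (x (lpos i)) (x (rpos i)) (y (lpos i)) (y (rpos i))).
  by rewrite !act_atN // over_ffunE.
Qed.

End Crossing.

(** An inverse generator acts through [rhoV], on which mediality says nothing
    directly; it is reached as the inverse of the positive crossing. *)
Lemma switch_hom_letter (X : switchType) (n : nat) (l : bletter n) :
  medial X -> switch_hom (@phi_letter X n l).
Proof.
case: l => i b /(switch_hom_crossing X n i) hi; case: b => //.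
exact: (switch_hom_inv _ _ _ _ (phi_letterK i true) (phi_letterK i false) hi).
Qed.

Lemma switch_hom_word (X : switchType) (n : nat) (w : bword n) :
  medial X -> switch_hom (@phi_word X n w).
Proof.
move=> med; elim: w => [|l w IH] /=.
  by move=> x y; apply: surjective_pairing.
exact: switch_hom_comp (switch_hom_letter X n l med) IH.
Qed.

Theorem theorem6 (X : switchType) (n : nat) (hn : 2 <= n) :
  (forall B : braid n, switch_hom (@phi X n B)) <-> medial X.
Proof.
split=> [h|med B]; last exact: switch_hom_word.
have i : 'I_n.-1 by apply: (@Ordinal _ 0); rewrite ltn_predRL.
apply/(switch_hom_crossing X n i).
exact: eq_switch_hom (phi_sigma i) (h (sigma i)).
Qed.
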